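(* (i) Let $X_1,X_2,Y_1,Y_2$ be real-valued random variables with distributions $F_1,F_2,G_1,G_2$ respectively, such that $\{X_1,X_2\}$, $\{Y_1,Y_2\}$ are GQAI. If $X_1,X_2$ are QAI, $Y_1,Y_2$ are QAI, and $(X_i,Y_j)\in\mathcal{C}^{(2)}$ for all $i,j\in\{1,2\}$, then $(X_1+X_2,\,Y_1+Y_2)\in\mathcal{C}^{(2)}$. (ii) Let $X_1,X_2,Y_1,Y_2$ be real-valued random variables with distributions $F_1,F_2,G_1,G_2$ respectively, such that $\{X_1,X_2\}$, $\{Y_1,Y_2\}$ are GQAI, $X_1,X_2$ are QAI and $Y_1,Y_2$ are QAI. If, for some $\alpha_1,\alpha_2>0$, $F_1,F_2\in\mathcal{R}_{-\alpha_1}$, $G_1,G_2\in\mathcal{R}_{-\alpha_2}$ and $(X_i,Y_j)\in\mathcal{R}^{(2)}_{(-\alpha_1,-\alpha_2)}$ for all $i,j\in\{1,2\}$, then $(X_1+X_2,\,Y_1+Y_2)\in\mathcal{R}^{(2)}_{(-\alpha_1,-\alpha_2)}$.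
   Context: $\overline F=1-F$ and $x\wedge y=\min\{x,y\}$; all distributions of the $X_i$, $Y_j$ satisfy $\overline F(x)>0$ for all $x\in\mathbb{R}$. Ratios of joint tails presuppose that the denominator is positive. Membership of a pair in a two-dimensional class refers to its joint distribution (the paper also writes $(F,G)\in\mathcal{B}^{(2)}$ for a pair with marginals $F,G$). One-dimensional classes: $F\in\mathcal{C}$ if $\lim_{z\uparrow1}\limsup_{x\to\infty}\overline F(zx)/\overline F(x)=1$; $F\in\mathcal{R}_{-\alpha}$ ($\alpha>0$) if $\lim_{x\to\infty}\overline F(tx)/\overline F(x)=t^{-\alpha}$ for all $t>0$. Two-dimensional classes, for a pair $(X,Y)$ with marginals $F,G$: - $(X,Y)\in\mathcal{C}^{(2)}$ if $F,G\in\mathcal{C}$ and $\lim_{(z_1,z_2)\uparrow(1,1)}\limsup_{x\wedge y\to\infty}\mathbf{P}[X>z_1x,Y>z_2y]/\mathbf{P}[X>x,Y>y]=1$. - $(X,Y)\in\mathcal{R}^{(2)}_{(-\alpha_1,-\alpha_2)}$ ($0<\alpha_1,\alpha_2<\infty$) if $F\in\mathcal{R}_{-\alpha_1}$, $G\in\mathcal{R}_{-\alpha_2}$ and $\lim_{x\wedge y\to\infty}\mathbf{P}[X>t_1x,Y>t_2y]/\mathbf{P}[X>x,Y>y]=t_1^{-\alpha_1}t_2^{-\alpha_2}$ for all $t_1,t_2>0$. QAI: random variables $X_1,X_2$ with distributions $F_1,F_2$ are (pairwise) quasi-asymptotically independent if $\lim_{x\to\infty}\mathbf{P}[|X_i|>x,X_j>x]/(\overline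 F_i(x)+\overline F_j(x))=0$ for $(i,j)=(1,2)$ and $(i,j)=(2,1)$; similarly for $Y_1,Y_2$. GQAI: $\{X_1,X_2\}$, $\{Y_1,Y_2\}$ are generalized quasi asymptotically independent if $$\lim_{x\wedge y\to\infty}\frac{\mathbf{P}[|X_i|>x,X_k>x,Y_j>y]}{\mathbf{P}[X_i>x,Y_j>y]+\mathbf{P}[X_k>x,Y_j>y]}=0$$ for all $i\neq k$ in $\{1,2\}$ and $j\in\{1,2\}$, and $$\lim_{x\wedge y\to\infty}\frac{\mathbf{P}[|Y_j|>y,Y_k>y,X_i>x]}{\mathbf{P}[X_i>x,Y_j>y]+\mathbf{P}[X_i>x,Y_k>y]}=0$$ for all $j\neq k$ in $\{1,2\}$ and $i\in\{1,2\}$. *)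

(* Defs.v *)
From HB Require Import structures.
From mathcomp Require Import all_boot all_order all_algebra.
From mathcomp Require Import all_classical all_reals all_analysis.
From mathcomp Require Import measurable_realfun.
Import Order.TTheory GRing.Theory Num.Theory.
Import numFieldNormedType.Exports.

Set Implicit Arguments.
Unset Strict Implicit.
Unset Printing Implicit Defensive.

Local Open Scope classical_set_scope.
Local Open Scope ring_scope.

(* The regime x /\ y --> oo; minoo_minE identifies it with the filter
   generated by the sets {(x, y) | M < min x y}. *)
Definition minoo (R : realType) : set_system (R * R) :=
  filter_prod (pinfty_nbhs R) (pinfty_nbhs R).

Lemma minoo_minE (R : realType) (V : set (R * R)) :
  minoo V <-> exists M : R, forall x y : R, M < Num.min x y -> V (x, y).
Proof.
split=> [[[A B] [[a [_ aA]] [b [_ bB]]] sV]|[M MV]].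
- exists (Num.max a b) => x y; rewrite lt_min !gt_max.
  move=> /andP[/andP[ax _] /andP[_ hy]].
  by apply: sV; split => /=; [exact: aA|exact: bB].
- exists ([set x | M < x], [set y | M < y]).
    by split; exists M; split => //; exact: num_real.
  by move=> [x y] /= [Mx My]; apply: MV; rewrite lt_min Mx My.
Qed.

Section classes_of_distributions.
Context {R : realType}.
Implicit Types (F : probability R R) (a x z t : R).

Definition tail F x : R := fine (F `]x, +oo[%classic).

Definition class_C F : Prop :=
  (forall x, 0 < tail F x) /\
  limf_esup (fun x => (tail F (z * x) / tail F x)%:E) (pinfty_nbhs R)
    @[z --> 1^'-] --> 1%:E.

(* the class R_{-a} *)
Definition class_RV a F : Prop :=
  (forall x, 0 < tail F x) /\
  forall t, 0 < t -> tail F (t * x) / tail F x @[x --> +oo] --> t `^ (- a).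

End classes_of_distributions.

Section pairs.
Context {d : measure_display} {T : measurableType d} {R : realType}.
Variable P : probability T R.
Implicit Types (X Y : {RV P >-> R}) (a x y t : R).

Definition prob (A : set T) : R := fine (P A).

Definition joint_tail X Y x y : R := prob [set w | x < X w /\ y < Y w].

(* The positivity clauses here and in GQAI make the ratios meaningful, as
   division by 0 is total. *)
Definition class_C2 X Y : Prop :=
  [/\ class_C (distribution P X), class_C (distribution P Y),
      forall x y, 0 < joint_tail X Y x y &
      limf_esup (fun p : R * R =>
          (joint_tail X Y (z.1 * p.1) (z.2 * p.2) /
           joint_tail X Y p.1 p.2)%:E) (@minoo R)
        @[z --> filter_prod (1 : R)^'- (1 : R)^'-] --> 1%:E].

(* the class R^(2)_{(-a1, -a2)} *)
Definition class_RV2 a1 a2 X Y : Prop :=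
  [/\ class_RV a1 (distribution P X), class_RV a2 (distribution P Y),
      forall x y, 0 < joint_tail X Y x y &
      forall t1 t2, 0 < t1 -> 0 < t2 ->
        joint_tail X Y (t1 * p.1) (t2 * p.2) / joint_tail X Y p.1 p.2
          @[p --> @minoo R] --> t1 `^ (- a1) * t2 `^ (- a2)].

Definition QAI (X : 'I_2 -> {RV P >-> R}) : Prop :=
  forall i j, i != j ->
    prob [set w | x < `|X i w| /\ x < X j w] /
      (tail (distribution P (X i)) x + tail (distribution P (X j)) x)
      @[x --> +oo] --> 0.

Definition GQAI (X Y : 'I_2 -> {RV P >-> R}) : Prop :=
  (forall i k j, i != k ->
    (forall x y,
       0 < joint_tail (X i) (Y j) x y + joint_tail (X k) (Y j) x y) /\
    prob [set w | [/\ p.1 < `|X i w|, p.1 < X k w & p.2 < Y j w]] /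
      (joint_tail (X i) (Y j) p.1 p.2 + joint_tail (X k) (Y j) p.1 p.2)
      @[p --> @minoo R] --> 0) /\
  (forall j k i, j != k ->
    (forall x y,
       0 < joint_tail (X i) (Y j) x y + joint_tail (X i) (Y k) x y) /\
    prob [set w | [/\ p.2 < `|Y j w|, p.2 < Y k w & p.1 < X i w]] /
      (joint_tail (X i) (Y j) p.1 p.2 + joint_tail (X i) (Y k) p.1 p.2)
      @[p --> @minoo R] --> 0).

End pairs.

Arguments class_C2 {d T R} P X Y.
Arguments class_RV2 {d T R} P a1 a2 X Y.

(* Main.v *)
Require Import Defs.
From HB Require Import structures.
From mathcomp Require Import all_boot all_order all_algebra.
From mathcomp Require Import all_classical all_reals all_analysis.
From mathcomp Require Import measurable_realfun.
From mathcomp Require Import ring lra.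
Import Order.TTheory GRing.Theory Num.Theory.
Import numFieldNormedType.Exports.

Local Open Scope classical_set_scope.
Local Open Scope ring_scope.

(** This is the principle of a single big jump, in two dimensions.  If
    X1 + X2 > x, then either one of the summands already exceeds c x, with c
    close to 1, or both exceed a fixed fraction of x.  Conversely X1 > x / c
    forces X1 + X2 > x unless |X2| is at least a fixed fraction of x.  Hence,
    on any event B,

      P[X1 + X2 > x, B]  and  P[X1 > x, B] + P[X2 > x, B]

    agree up to a rescaling of x by c or 1 / c and up to the probability that
    both variables are large on B ([sum_exceeds_le], [sum_exceeds_ge]).  With
    B the whole space this treats each marginal; applied first to the X's with
    B an event about Y1 + Y2, and then to the Y's with B an event about a
    single Xi, it treats the joint tail ([joint_tail_sum_le],
    [joint_tail_sum_ge]).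

    Quasi-asymptotic independence makes the remainder negligible with respect
    to the sum of the tails taken at the same fraction of the argument.
    Consistent variation removes both blemishes: iterated, it bounds the tails
    at a fraction of the argument by a multiple of the tails at the argument,
    so the remainder stays negligible; and letting c tend to 1, it absorbs the
    rescaling.  So the tail of the sum is equivalent to the sum of the tails
    ([sandwich_equivalent]).  Consistent variation and regular variation are
    stable under sums of positive functions and under equivalence, and regular
    variation implies consistent variation, so both parts follow.

    One and two dimensions are handled by the same argument: a tail is a
    function on a vector space V (here R or R * R) which is compared with its
    dilations along a filter on V that is invariant under dilations. *)

(** * Limits of upper limits *)

Section limf_esup_bounds.
Context {R : realType} {B : choiceType} {U : filteredType B} {F : set_system U}.
Implicit Types (f : U -> \bar R) (a b : \bar R).
Local Open Scope ereal_scope.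

Lemma limf_esup_le f b : (\forall p \near F, f p <= b) -> limf_esup f F <= b.
Proof.
move=> fb; rewrite limf_esupE.
apply: (@le_trans _ _ (ereal_sup (f @` [set p | f p <= b]))).
  by apply: ereal_inf_lbound; exists [set p | f p <= b].
by apply: ge_ereal_sup => _ [p pb <-].
Qed.

Lemma limf_esup_ge {FF : ProperFilter F} f a :
  (\forall p \near F, a <= f p) -> a <= limf_esup f F.
Proof.
move=> af; rewrite limf_esupE; apply: le_ereal_inf_tmp => _ [A FA <-].
have [p [ap Ap]] := filter_ex (filterI af FA).
by apply: le_trans ap _; apply: ereal_sup_ubound; exists p.
Qed.

Lemma near_limf_esup_lt {FF : Filter F} f b :
  limf_esup f F < b -> \forall p \near F, f p < b.
Proof.
rewrite limf_esupE => /ereal_inf_lt[_ [A FA <-]] Ab.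
apply: filterS FA => p Ap; apply: le_lt_trans Ab.
by apply: ereal_sup_ubound; exists p.
Qed.

End limf_esup_bounds.

Section limsup_one.
Context {R : realType} {Z : Type} {B : choiceType} {U : filteredType B}.
Context {G : set_system Z} {F : set_system U}.
Context {GG : ProperFilter G} {FF : ProperFilter F}.
Variable r : Z -> U -> R.

(** With its partial converse [near_cvg_limf_esup1], this trades the limit of
    upper limits that defines the classes C and C^(2) for a statement about
    ratios with two nested filters.  For tails the lower bound by 1 is their
    monotonicity. *)
Lemma cvg_limf_esup1 :
  (forall e, 0 < e ->
    \forall z \near G, \forall p \near F, 1 <= r z p <= 1 + e) ->
  limf_esup (fun p => (r z p)%:E) F @[z --> G] --> 1%:E.
Proof.
move=> r1; apply/fine_cvgP.
have bnd e : 0 < e -> \forall z \near G,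
    (1%:E <= limf_esup (fun p => (r z p)%:E) F <= (1 + e)%:E)%E.
  move=> /r1; apply: filterS => z rz; apply/andP; split.
    by apply: limf_esup_ge; apply: filterS rz => p /andP[]; rewrite lee_fin.
  by apply: limf_esup_le; apply: filterS rz => p /andP[]; rewrite lee_fin.
split.
  apply: filterS (bnd 1 ltr01) => z /andP[l1 l2].
  rewrite fin_numE; apply/andP; split; apply/eqP => le.
    by move: l1; rewrite le.
  by move: l2; rewrite le.
apply/cvgrPdist_le => e /bnd; apply: filterS => z /= /andP[].
case: (limf_esup _ F) => [s| |] //=.
rewrite !lee_fin => s1 s2; rewrite distrC ger0_norm; lra.
Qed.

Lemma near_cvg_limf_esup1 :
  limf_esup (fun p => (r z p)%:E) F @[z --> G] --> 1%:E ->
  forall e, 0 < e -> \forall z \near G, \forall p \near F, r z p <= 1 + e.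
Proof.
move=> /fine_cvgP[fin cv] e e0.
have lt1 : 1 < 1 + e by rewrite ltrDl.
near=> z.
have finz : limf_esup (fun p => (r z p)%:E) F \is a fin_num by near: z.
have : (limf_esup (fun p => (r z p)%:E) F < (1 + e)%:E)%E.
  rewrite -(fineK finz) lte_fin; near: z.
  exact: (cvgr_lt _ cv _ lt1).
by move=> /near_limf_esup_lt; apply: filterS => p; rewrite lte_fin => /ltW.
Unshelve. all: by end_near. Qed.

End limsup_one.

(** * Consistent variation along a filter invariant under dilations *)

Section consistent_variation.
Context {R : realType} {V : lmodType R}.
Implicit Types (F : set_system V) (J S N : V -> R).

Definition scaling_filter F :=
  forall (c : R) (A : set V), 0 < c -> F A -> \forall p \near F, A (c *: p).

(** Only monotonicity along rays, and only eventually: tails are monotone in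
    each coordinate, so dilation decreases them where the coordinates are
    nonnegative. *)
Definition radially_nonincreasing F J := forall a b : R, 0 < a -> a <= b ->
  \forall p \near F, J (b *: p) <= J (a *: p).

(** The classes C and C^(2) restricted to dilations.  In two dimensions this
    loses nothing, since the joint tail at (z1 x, z2 y) is squeezed between its
    values at (x, y) and at (c x, c y), where c <= z1, z2 < 1. *)
Definition consistently_varying F J :=
  [/\ \forall p \near F, 0 < J p, radially_nonincreasing F J &
    forall e, 0 < e -> exists2 c, 0 < c < 1 &
      \forall p \near F, J (c *: p) <= (1 + e) * J p].

Context {F : set_system V} {FF : ProperFilter F}.
Hypothesis FZ : scaling_filter F.

Lemma radially_nonincreasingD J1 J2 : radially_nonincreasing F J1 ->
  radially_nonincreasing F J2 -> radially_nonincreasing F (J1 \+ J2).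
Proof.
move=> m1 m2 a b a0 ab; apply: filterS2 (m1 _ _ a0 ab) (m2 _ _ a0 ab) => p.
exact: lerD.
Qed.

Lemma consistently_varyingD J1 J2 : consistently_varying F J1 ->
  consistently_varying F J2 -> consistently_varying F (J1 \+ J2).
Proof.
move=> [p1 m1 c1] [p2 m2 c2]; split.
- by apply: filterS2 p1 p2 => p; exact: addr_gt0.
- exact: radially_nonincreasingD.
move=> e e0; have [a /andP[a0 a1] Ha] := c1 e e0.
have [b /andP[b0 b1] Hb] := c2 e e0.
exists (Num.max a b); first by rewrite lt_max a0 gt_max a1 b1.
have ma := m1 a (Num.max a b) a0 ltac:(by rewrite le_max lexx).
have mb := m2 b (Num.max a b) b0 ltac:(by rewrite le_max lexx orbT).
near=> p; rewrite /= mulrDr; apply: lerD.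
  by apply: (@le_trans _ _ (J1 (a *: p))); near: p.
by apply: (@le_trans _ _ (J2 (b *: p))); near: p.
Unshelve. all: by end_near. Qed.

(** Iterating the bound for a single factor c reaches every fraction d, since
    the powers of c tend to 0. *)
Lemma consistently_varying_dominated J (d : R) : consistently_varying F J -> 0 < d ->
  exists2 K, 0 < K & \forall p \near F, J (d *: p) <= K * J p.
Proof.
move=> [J0 Jm /(_ 1 ltr01)[c /andP[c0 c1] Jc]] d0.
have iter n : \forall p \near F, J (c ^+ n *: p) <= (1 + 1) ^+ n * J p.
  elim: n => [|n IH].
    by apply: filterE => p; rewrite !expr0 scale1r mul1r.
  apply: filterS2 (FZ c _ c0 IH) Jc => p pn pc.
  rewrite exprSr -scalerA (le_trans pn)// exprSr -mulrA ler_pM2l//.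
have [n cn] : exists n, c ^+ n <= d.
  have : (c ^+ n @[n --> \oo] --> 0) by apply: cvg_expr; rewrite gtr0_norm.
  move=> /cvgr_le /(_ d d0)[n _ nd]; exists n; exact: (nd n (leqnn n)).
exists ((1 + 1) ^+ n); first by rewrite exprn_gt0// addr_gt0.
apply: filterS2 (iter n) (Jm _ _ (exprn_gt0 n c0) cn) => p pn pd.
exact: le_trans pd pn.
Qed.

(** The remainder N is evaluated at the fraction c (1 - c), which is at most
    c and at most both 1 - c and 1 / c - 1: this is the room left for the
    second summand when the first is compared with c p or with p / c. *)
Lemma sandwich_equivalent S T N : consistently_varying F T ->
  (forall p, 0 <= N p) -> N p / T p @[p --> F] --> 0 ->
  (forall c, 0 < c < 1 -> \forall p \near F,
     S p <= T (c *: p) + N ((c * (1 - c)) *: p)) ->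
  (forall c, 0 < c < 1 -> \forall p \near F,
     T (c^-1 *: p) <= S p + N ((c * (1 - c)) *: p)) ->
  S p / T p @[p --> F] --> (1 : R).
Proof.
move=> cT N0 /cvgr0Pnorm_le NT upS loS; apply/cvgrPdist_le => e e0.
have [T0 _ Tc] := cT.
have e20 : 0 < e / 2 by rewrite divr_gt0.
have [c /[dup] c01 /andP[c0 c1] {}Tc] := Tc _ e20.
have d0 : 0 < c * (1 - c) by rewrite mulr_gt0// subr_gt0.
set d := c * (1 - c) in d0.
have [K K0 TK] := consistently_varying_dominated _ _ cT d0.
have Nd : \forall p \near F, N (d *: p) <= e / 2 * T p.
  have eK : 0 < e / 2 / K by rewrite divr_gt0.
  have NTd := FZ _ _ d0 (NT _ eK).
  have T0d := FZ _ _ d0 T0.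
  near=> p.
  have Tp : 0 < T (d *: p) by near: p.
  have : `|N (d *: p) / T (d *: p)| <= e / 2 / K by near: p.
  rewrite ger0_norm ?divr_ge0 ?(ltW Tp)// ler_pdivrMr// => /le_trans; apply.
  rewrite -[leLHS]mulrA ler_pM2l// mulrC ler_pdivrMr// mulrC; near: p.
  exact: TK.
have ci0 : 0 < c^-1 by rewrite invr_gt0.
have Tci := FZ _ _ ci0 Tc.
have uc := upS _ c01; have lc := loS _ c01.
near=> p.
have Tp : 0 < T p by near: p.
have Np : N (d *: p) <= e / 2 * T p by near: p.
have u1 : S p <= T (c *: p) + N (d *: p) by near: p.
have u2 : T (c *: p) <= (1 + e / 2) * T p by near: p.
have l1 : T (c^-1 *: p) <= S p + N (d *: p) by near: p.
have l2 : T (c *: (c^-1 *: p)) <= (1 + e / 2) * T (c^-1 *: p) by near: p.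
(* The lower bound uses the variation of T at p / c rather than at p. *)
rewrite scalerA divff ?gt_eqF// scale1r in l2.
have l3 : (1 - e / 2) * T p <= T (c^-1 *: p).
  have : (1 - e / 2) * T p <= T p / (1 + e / 2).
    by rewrite ler_pdivlMr ?addr_gt0//; nra.
  move=> /le_trans; apply; rewrite ler_pdivrMr ?addr_gt0//; lra.
rewrite -(divff (lt0r_neq0 Tp)) -mulrBl normrM normfV (gtr0_norm Tp).
rewrite ler_pdivrMr// ler_norml; apply/andP; split; lra.
Unshelve. all: by end_near. Qed.

Lemma equivalent_gt0 S T : (\forall p \near F, 0 < T p) ->
  S p / T p @[p --> F] --> (1 : R) -> \forall p \near F, 0 < S p.
Proof.
move=> T0 /cvgr_gt /(_ 0 ltr01); apply: filterS2 T0 => p Tp.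
by rewrite pmulr_lgt0// invr_gt0.
Qed.

Lemma equivalent_ratio (phi : V -> V) S T (l : R) : phi p @[p --> F] --> F ->
  (\forall p \near F, 0 < T p) -> S p / T p @[p --> F] --> (1 : R) ->
  T (phi p) / T p @[p --> F] --> l -> S (phi p) / S p @[p --> F] --> l.
Proof.
move=> phiF T0 ST Tl.
have S0 := equivalent_gt0 _ _ T0 ST.
have STphi : S (phi p) / T (phi p) @[p --> F] --> (1 : R).
  exact: (@cvg_comp _ _ _ phi (fun p => S p / T p) _ _ _ phiF ST).
have TS : (S p / T p)^-1 @[p --> F] --> (1 : R).
  rewrite -[X in _ --> X]invr1; apply: cvgV => //; exact: oner_neq0.
rewrite -[l]mul1r -[1 * l]mulr1.
apply: cvg_trans (cvgM (cvgM STphi Tl) TS).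
apply: near_eq_cvg; have T0phi := phiF _ T0.
near=> p.
have ? : T p != 0 by apply: lt0r_neq0; near: p.
have ? : S p != 0 by apply: lt0r_neq0; near: p.
have ? : T (phi p) != 0 by apply: lt0r_neq0; near: p; exact: T0phi.
rewrite /=; field; repeat (apply/andP; split) => //.
Unshelve. all: by end_near. Qed.

Lemma consistently_varying_equivalent S T : consistently_varying F T ->
  radially_nonincreasing F S -> S p / T p @[p --> F] --> (1 : R) ->
  consistently_varying F S.
Proof.
move=> [T0 _ Tc] Sm ST; split => //; first exact: equivalent_gt0 T0 ST.
move=> e e0.
(* This u satisfies (1 + u) ^ 2 <= (1 + e) (1 - u): one factor 1 + u and the
   factor 1 - u come from S ~ T, the other 1 + u from the variation of T. *)
pose u := Num.min (2^-1) (e / 8).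
have u0 : 0 < u by rewrite lt_min invr_gt0 divr_gt0 ?andbT//; lra.
have [u2 u8] : u <= 2^-1 /\ u <= e / 8 by rewrite !ge_min !lexx orbT.
have [c /[dup] c01 /andP[c0 _] {}Tc] := Tc _ u0.
exists c => //.
move: ST => /cvgrPdist_le /(_ _ u0) ST.
have STc := FZ _ _ c0 ST.
have T0c := FZ _ _ c0 T0.
near=> p.
have Tp : 0 < T p by near: p.
have Tcp : 0 < T (c *: p) by near: p.
have : `|1 - S p / T p| <= u by near: p.
have : `|1 - S (c *: p) / T (c *: p)| <= u by near: p.
rewrite !ler_norml => /andP[+ _] /andP[_ +].
rewrite lerBrDr -lerBrDl opprK ler_pdivrMr// => Sc.
rewrite lerBlDr -lerBlDl ler_pdivlMr// => Sp.
have Tc' : T (c *: p) <= (1 + u) * T p by near: p.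
have Sc' : S (c *: p) <= (1 + u) * ((1 + u) * T p).
  by apply: le_trans Sc _; rewrite ler_pM2l// addr_gt0.
apply: le_trans Sc' _; apply: le_trans (_ : (1 + e) * ((1 - u) * T p) <= _).
  rewrite !mulrA ler_pM2r//; nra.
by rewrite ler_pM2l// addr_gt0.
Unshelve. all: by end_near. Qed.

(** The ratio of sums is a weighted mean of the ratios, so a common limit is
    inherited.  Here phi is any change of argument, for instance
    (x, y) |-> (t1 x, t2 y). *)
Lemma regularly_varyingD (phi : V -> V) J1 J2 (l : R) :
  (\forall p \near F, 0 < J1 p) -> (\forall p \near F, 0 < J2 p) ->
  J1 (phi p) / J1 p @[p --> F] --> l -> J2 (phi p) / J2 p @[p --> F] --> l ->
  (J1 (phi p) + J2 (phi p)) / (J1 p + J2 p) @[p --> F] --> l.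
Proof.
move=> p1 p2 /cvgrPdist_le l1 /cvgrPdist_le l2; apply/cvgrPdist_le => e e0.
near=> p.
have J1p : 0 < J1 p by near: p.
have J2p : 0 < J2 p by near: p.
have : `|l - J1 (phi p) / J1 p| <= e by near: p; exact: l1.
have : `|l - J2 (phi p) / J2 p| <= e by near: p; exact: l2.
have dist (x y : R) : 0 < y -> (`|l - x / y| <= e) = (`|l * y - x| <= e * y).
  move=> y0; rewrite -(ler_pM2r y0) -[X in _ * X <= _](gtr0_norm y0) -normrM.
  by rewrite mulrBl divfK ?gt_eqF.
rewrite !dist ?addr_gt0// => d2 d1.
rewrite [in leLHS]mulrDr opprD addrACA mulrDr.
exact: le_trans (ler_normD _ _) (lerD d1 d2).
Unshelve. all: by end_near. Qed.

(** The factor c is chosen so that c ^ (- a) = 1 + e / 2, which leaves a margin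
    for the convergence of the ratio. *)
Lemma regular_consistently_varying J (a : R) : 0 < a ->
  (\forall p \near F, 0 < J p) -> radially_nonincreasing F J ->
  (forall c : R, 0 < c -> J (c *: p) / J p @[p --> F] --> c `^ (- a)) ->
  consistently_varying F J.
Proof.
move=> a0 J0 Jm Ja; split=> // e e0.
have e1 : 1 < 1 + e / 2 by lra.
exists ((1 + e / 2) `^ (- a^-1)).
  rewrite powR_gt0 ?(lt_trans ltr01)//= powRN invf_lt1 ?powR_gt0 ?(lt_trans ltr01)//.
  rewrite -[ltLHS](congr1 (@^~ a^-1) (@powR1 R))/=.
  by apply: gt0_ltr_powR; rewrite ?invr_gt0 ?nnegrE//; lra.
have c0 : 0 < (1 + e / 2) `^ (- a^-1) by apply: powR_gt0; lra.
have := Ja _ c0; rewrite -powRrM mulrNN mulVf ?gt_eqF// powRr1; last lra.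
move=> /cvgr_le /(_ (1 + e) ltac:(lra)); apply: filterS2 J0 => p Jp.
by rewrite ler_pdivrMr.
Qed.

Lemma negligible_le N J T : (forall p, 0 <= N p) ->
  (\forall p \near F, 0 < J p <= T p) ->
  N p / J p @[p --> F] --> 0 -> N p / T p @[p --> F] --> 0.
Proof.
move=> N0 JT; apply: squeeze_cvgr (cvg_cst 0).
apply: filterS JT => p /andP[Jp JT]; apply/andP; split.
  by rewrite divr_ge0// ltW// (lt_le_trans Jp).
by rewrite ler_wpM2l// lef_pV2// posrE// (lt_le_trans Jp).
Qed.

End consistent_variation.

(** * The filters at infinity on the line and on the plane *)

Section scaling.
Context {R : realType}.

Lemma scaling_pinfty : scaling_filter (pinfty_nbhs R).
Proof.
move=> c A c0 [M [Mr MA]]; exists (M / c); split; first exact: num_real.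
by move=> x; rewrite ltr_pdivrMr// mulrC => /MA.
Qed.

Global Instance minoo_filter : ProperFilter (@minoo R).
Proof. exact: filter_prod_proper. Qed.

Lemma scaling_minoo : scaling_filter (@minoo R).
Proof.
move=> c A c0 /minoo_minE[M MA]; apply/minoo_minE; exists (M / c) => x y.
rewrite lt_min !ltr_pdivrMr// => /andP[cx cy]; apply: MA.
by rewrite lt_min ![_ *: _]mulrC cx cy.
Qed.

Lemma minoo_gt (M : R) : \forall p \near @minoo R, M < p.1 /\ M < p.2.
Proof. by apply/minoo_minE; exists M => x y; rewrite lt_min => /andP. Qed.

Lemma pinfty_radially_nonincreasing (J : R -> R) :
  (forall x y, x <= y -> J y <= J x) -> radially_nonincreasing (pinfty_nbhs R) J.
Proof.
move=> Jm a b a0 ab; apply: filterS (nbhs_pinfty_ge (num_real 0)) => x x0.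
by apply: Jm; exact: ler_wpM2r.
Qed.

Lemma minoo_radially_nonincreasing (J : R -> R -> R) :
  (forall x x' y y', x <= x' -> y <= y' -> J x' y' <= J x y) ->
  radially_nonincreasing (@minoo R) (fun p => J p.1 p.2).
Proof.
move=> Jm a b a0 ab; apply: filterS (minoo_gt 0) => p [/ltW x0 /ltW y0].
by apply: Jm; exact: ler_wpM2r.
Qed.

End scaling.

Section class_C_as_consistent_variation.
Context {R : realType}.
Implicit Types F : probability R R.

Lemma tail_nonincreasing F x y : x <= y -> tail F y <= tail F x.
Proof.
move=> xy; rewrite fine_le ?fin_num_measure//.
by apply: le_measure; rewrite ?inE//; apply: subset_itvr; rewrite bnd_simp.
Qed.

Lemma class_C_consistently_varying F :
  class_C F <-> (forall x, 0 < tail F x) /\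
    consistently_varying (pinfty_nbhs R) (tail F).
Proof.
have Fm := pinfty_radially_nonincreasing _ (tail_nonincreasing F).
split=> [[F0 Fc]|[F0 [_ _ Fc]]]; split=> //.
  split=> //; first exact: nearW.
  move=> e e0; have zC : \forall z \near (1 : R)^'-, \forall x \near +oo,
      tail F (z * x) / tail F x <= 1 + e by exact: near_cvg_limf_esup1 Fc _ e0.
  have z1 : \forall z \near (1 : R)^'-, 0 < z < 1.
    near=> z; apply/andP.
    by split; near: z; [exact: nbhs_left_gt|exact: nbhs_left_lt].
  have [c [c01 cF]] := filter_ex (filterI z1 zC).
  by exists c => //; apply: filterS cF => x; rewrite ler_pdivrMr.
apply: cvg_limf_esup1 => e e0; have [c /andP[c0 c1] Fce] := Fc e e0.
near=> z; near=> x.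
have cz : c < z by near: z; exact: nbhs_left_gt.
have z1 : z < 1 by near: z; exact: nbhs_left_lt.
have x0 : 0 < x by near: x; exact: nbhs_pinfty_gt.
rewrite ler_pdivlMr// mul1r ler_pdivrMr//; apply/andP; split.
  by apply: tail_nonincreasing; rewrite ger_pMl// ltW.
apply: (@le_trans _ _ (tail F (c * x))).
  by apply: tail_nonincreasing; rewrite ler_pM2r// ltW.
by near: x; exact: Fce.
Unshelve. all: by end_near. Qed.

End class_C_as_consistent_variation.

(** * One big jump *)

Section exceedances.
Context {d : measure_display} {T : measurableType d} {R : realType}.
Variable P : probability T R.
Implicit Types (A B C : set T) (X Y : {RV P >-> R}).

Lemma prob_ge0 A : 0 <= prob P A.
Proof. by rewrite /prob fine_ge0. Qed.

Lemma prob_le A B : measurable A -> measurable B -> A `<=` B ->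
  prob P A <= prob P B.
Proof.
move=> mA mB AB; rewrite fine_le ?fin_num_measure//.
by apply: le_measure; rewrite ?inE.
Qed.

Lemma prob_leU A B C : measurable A -> measurable B -> measurable C ->
  A `<=` B `|` C -> prob P A <= prob P B + prob P C.
Proof.
move=> mA mB mC ABC; rewrite -fineD ?fin_num_measure//.
rewrite fine_le ?fin_numD ?fin_num_measure//.
apply: (@le_trans _ _ (P (B `|` C))); last exact: measureU2.
by apply: le_measure; rewrite ?inE//; exact: measurableU.
Qed.

Lemma prob_disjoint_le A B C : measurable A -> measurable B -> measurable C ->
  [disjoint A & B] -> A `<=` C -> B `<=` C -> prob P A + prob P B <= prob P C.
Proof.
move=> mA mB mC /disj_setPS AB AC BC; rewrite -fineD ?fin_num_measure//.
rewrite -measureU//; last exact/seteqP.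
apply: prob_le => //; first exact: measurableU.
by rewrite subUset.
Qed.

Definition exceeds (f : T -> R) (x : R) : set T := [set w | x < f w].

Lemma measurable_exceeds (f : T -> R) x :
  measurable_fun setT f -> measurable (exceeds f x).
Proof.
move=> mf; rewrite (_ : exceeds f x = setT `&` f @^-1` `]x, +oo[).
  exact: mf.
by rewrite setTI; apply/seteqP; split=> w /=; rewrite in_itv/= andbT.
Qed.

Lemma measurable_exceedsRV (X : {mfun T >-> R}) x : measurable (exceeds X x).
Proof. exact: measurable_exceeds. Qed.

Lemma measurable_exceedsN (X : {mfun T >-> R}) x :
  measurable (exceeds (Num.norm \o X) x).
Proof. by apply: measurable_exceeds; exact: measurableT_comp. Qed.

Lemma tail_distribution X x : tail (distribution P X) x = prob P (exceeds X x).
Proof.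
congr (fine (P _)); apply/seteqP.
by split=> w /=; rewrite in_itv/= andbT.
Qed.

End exceedances.
#[global] Hint Extern 0 (measurable (exceeds _ _)) =>
  solve [exact: measurable_exceedsRV|exact: measurable_exceedsN] : core.

Section one_big_jump.
Context {d : measure_display} {T : measurableType d} {R : realType}.
Context {P : probability T R}.
Implicit Types (B C : set T).

(** The absolute values are what the lower bound needs: a large negative
    summand can cancel a large positive one. *)
Definition two_jumps (X1 X2 : {RV P >-> R}) (x : R) (B : set T) : R :=
  prob P (exceeds (Num.norm \o X1) x `&` exceeds X2 x `&` B) +
  prob P (exceeds (Num.norm \o X2) x `&` exceeds X1 x `&` B).

Variables X1 X2 : {RV P >-> R}.

Lemma two_jumps_ge0 x B : 0 <= two_jumps X1 X2 x B.
Proof. by rewrite addr_ge0 ?prob_ge0. Qed.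

Lemma two_jumps_le x B C : measurable B -> measurable C -> B `<=` C ->
  two_jumps X1 X2 x B <= two_jumps X1 X2 x C.
Proof.
move=> mB mC BC; apply: lerD; apply: prob_le; do ?apply: measurableI => //.
  - exact: setIS.
  - exact: setIS.
Qed.

Lemma two_jumps_leU x B C D : measurable B -> measurable C -> measurable D ->
  B `<=` C `|` D ->
  two_jumps X1 X2 x B <= two_jumps X1 X2 x C + two_jumps X1 X2 x D.
Proof.
move=> mB mC mD BCD; rewrite /two_jumps addrACA.
by apply: lerD; apply: prob_leU; do ?apply: measurableI => //;
  rewrite -setIUr; exact: setIS.
Qed.

(** If neither summand exceeds u, then each exceeds x - u >= v. *)
Lemma sum_exceeds_le x u v B : measurable B -> u + v <= x ->
  prob P (exceeds (X1 + X2) x `&` B) <=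
  prob P (exceeds X1 u `&` B) + prob P (exceeds X2 u `&` B) +
  two_jumps X1 X2 v B.
Proof.
move=> mB uvx.
have mI (A : set T) : measurable A -> measurable (A `&` B).
  by move=> mA; exact: measurableI.
apply: (@le_trans _ _ (prob P ((exceeds X1 u `&` B) `|` (exceeds X2 u `&` B)) +
    prob P (exceeds (Num.norm \o X1) v `&` exceeds X2 v `&` B))).
  apply: prob_leU; do ?[apply: measurableU|apply: mI|apply: measurableI] => //.
  move=> w [/= xw Bw].
  have [X1u|X1u] := ltP u (X1 w); first by left; left.
  have [X2u|X2u] := ltP u (X2 w); first by left; right.
  have {}xw : x < X1 w + X2 w := xw.
  right; split=> //; split; rewrite /exceeds/=; last lra.
  by apply: lt_le_trans (ler_norm _); lra.
apply: lerD; last by rewrite lerDl prob_ge0.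
by apply: prob_leU; do ?[apply: measurableU|apply: mI] => //.
Qed.

(** The events that exactly one summand jumps, Xi > u while the other one is
    at most v in absolute value, are disjoint because v <= u, and each of them
    forces the sum above x because x + v <= u. *)
Lemma sum_exceeds_ge x u v B : measurable B -> v <= u -> x + v <= u ->
  prob P (exceeds X1 u `&` B) + prob P (exceeds X2 u `&` B) <=
  prob P (exceeds (X1 + X2) x `&` B) + two_jumps X1 X2 v B.
Proof.
move=> mB vu xvu.
pose only (X X' : {RV P >-> R}) :=
  exceeds X u `&` ~` exceeds (Num.norm \o X') v `&` B.
have mo X X' : measurable (only X X').
  by apply: measurableI => //; apply: measurableI => //; exact: measurableC.
have split_only (X X' : {RV P >-> R}) : prob P (exceeds X u `&` B) <=
    prob P (only X X') + prob P (exceeds (Num.norm \o X') v `&` exceeds X v `&` B).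
  apply: prob_leU => //; do ?apply: measurableI => //.
  move=> w [/= Xw Bw]; have [X'v|X'v] := boolP (v < `|X' w|).
    by right; split=> //; split=> //; apply: le_lt_trans Xw.
  by left; split=> //; split=> //; exact/negP.
have : prob P (only X1 X2) + prob P (only X2 X1) <=
    prob P (exceeds (X1 + X2) x `&` B).
  apply: prob_disjoint_le => //; first exact: measurableI.
  - apply/disj_setPS => w [[[X1u _] _] [[_ /negP]]].
    rewrite /exceeds/= in X1u *; have := ler_norm (X1 w); lra.
  - move=> w [[X1u /negP]]; rewrite -leNgt /= ler_norml => /andP[X2v _] Bw.
    by split=> //; rewrite /exceeds/= in X1u *; change (x < X1 w + X2 w); lra.
  - move=> w [[X1u /negP]]; rewrite -leNgt /= ler_norml => /andP[X2v _] Bw.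
    by split=> //; rewrite /exceeds/= in X1u *; change (x < X1 w + X2 w); lra.
have := split_only X1 X2; have := split_only X2 X1; rewrite /two_jumps; lra.
Qed.

(** One of two summands exceeds any level which is at most half of a level
    exceeded by the sum. *)
Lemma two_jumps_exceeds_sum_le (Y1 Y2 : {RV P >-> R}) x y v : v + v <= y ->
  two_jumps X1 X2 x (exceeds (Y1 + Y2) y) <=
  two_jumps X1 X2 x (exceeds Y1 v) + two_jumps X1 X2 x (exceeds Y2 v).
Proof.
move=> vy; apply: two_jumps_leU => // w yS; have {}yS : y < Y1 w + Y2 w := yS.
have [|Yw] := ltP v (Y1 w); first by left.
by right; rewrite /exceeds/=; lra.
Qed.

End one_big_jump.

(** The fraction c (1 - c) fits between c and 1 and between 1 and 1 / c, as
    [sum_exceeds_le] and [sum_exceeds_ge] require, and it is at most one half,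
    as [two_jumps_exceeds_sum_le] requires. *)
Lemma jump_level {R : realType} (c : R) : 0 < c < 1 ->
  [/\ 0 < c * (1 - c), c * (1 - c) <= c, c * (1 - c) + c * (1 - c) <= 1,
      c + c * (1 - c) <= 1 & 1 + c * (1 - c) <= c^-1].
Proof.
move=> /andP[c0 c1]; have c'0 : 0 < 1 - c by rewrite subr_gt0.
have c2 : 0 <= c ^+ 2 := sqr_ge0 c.
have c'2 : 0 <= (1 - c) ^+ 2 := sqr_ge0 (1 - c).
split; [exact: mulr_gt0|lra..|].
rewrite -[leRHS]mul1r ler_pdivlMr//.
have := mulr_ge0 (ltW c0) c'2; lra.
Qed.

(** * Tail of a sum *)

Section one_dimensional_sum.
Context {d : measure_display} {T : measurableType d} {R : realType}.
Context {P : probability T R}.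
Implicit Types X : {RV P >-> R}.

Lemma tail_gt0_near (F : probability R R) :
  (\forall x \near +oo, 0 < tail F x) -> forall x, 0 < tail F x.
Proof.
move=> F0 x.
have [y [xy Fy]] := filter_ex (filterI (nbhs_pinfty_ge (num_real x)) F0).
exact: lt_le_trans Fy (tail_nonincreasing _ _ _ xy).
Qed.

Lemma tail_sum_equivalent X1 X2 :
  let sum_tails x := tail (distribution P X1) x + tail (distribution P X2) x in
  consistently_varying (pinfty_nbhs R) sum_tails ->
  two_jumps X1 X2 x setT / sum_tails x @[x --> +oo] --> 0 ->
  tail (distribution P (X1 + X2)) x / sum_tails x @[x --> +oo] --> (1 : R).
Proof.
move=> sum_tails cvT jumps.
apply: (sandwich_equivalent scaling_pinfty _ _ (two_jumps X1 X2 ^~ setT)) => //.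
- by move=> x; exact: two_jumps_ge0.
- move=> c c01; have [v0 _ _ cv1 _] := jump_level _ c01; near=> x.
  have x0 : 0 < x by near: x; exact: nbhs_pinfty_gt.
  rewrite /sum_tails !tail_distribution /=.
  have := @sum_exceeds_le _ _ _ P X1 X2 x (c * x) (c * (1 - c) * x) setT.
  by rewrite !setIT; apply=> //; nra.
- move=> c c01; have [v0 _ _ _ civ] := jump_level _ c01; near=> x.
  have x0 : 0 < x by near: x; exact: nbhs_pinfty_gt.
  rewrite /sum_tails !tail_distribution /=.
  have := @sum_exceeds_ge _ _ _ P X1 X2 x (c^-1 * x) (c * (1 - c) * x) setT.
  by rewrite !setIT; apply=> //; nra.
Unshelve. all: by end_near. Qed.

Lemma QAI_two_jumps (X : 'I_2 -> {RV P >-> R}) : QAI X ->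
  two_jumps (X ord0) (X ord_max) x setT /
    (tail (distribution P (X ord0)) x + tail (distribution P (X ord_max)) x)
    @[x --> +oo] --> 0.
Proof.
move=> qX; rewrite -[X in _ --> X]addr0.
apply: cvg_trans (cvgD (qX ord0 ord_max isT) (qX ord_max ord0 isT)).
apply: near_eq_cvg; near=> x => /=.
by rewrite mulrDl !setIT [in X in _ = _ + _ / X]addrC.
Unshelve. all: by end_near. Qed.

End one_dimensional_sum.

(** * Joint tail of two sums *)

Lemma ord2_cases (i : 'I_2) : i = ord0 \/ i = ord_max.
Proof.
by case: i => [[|[|i]] ?] //; [left|right]; exact: val_inj.
Qed.

Section two_dimensional_sum.
Context {d : measure_display} {T : measurableType d} {R : realType}.
Context {P : probability T R}.
Implicit Types X Y : {RV P >-> R}.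

Lemma joint_tailE X Y x y :
  joint_tail X Y x y = prob P (exceeds X x `&` exceeds Y y).
Proof. by []. Qed.

Lemma joint_tail_nonincreasing X Y x x' y y' : x <= x' -> y <= y' ->
  joint_tail X Y x' y' <= joint_tail X Y x y.
Proof.
move=> xx' yy'; rewrite !joint_tailE.
apply: prob_le; do ?exact: measurableI.
by move=> w [/(le_lt_trans xx') ? /(le_lt_trans yy')].
Qed.

Lemma joint_tail_gt0_near X Y :
  (\forall p \near @minoo R, 0 < joint_tail X Y p.1 p.2) ->
  forall x y, 0 < joint_tail X Y x y.
Proof.
move=> J0 x y.
have [p [[+ +] Jp]] := filter_ex (filterI (minoo_gt (Num.max x y)) J0).
rewrite !gt_max => /andP[/ltW xp _] /andP[_ /ltW yp].
exact: lt_le_trans Jp (joint_tail_nonincreasing _ _ _ _ _ _ xp yp).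
Qed.

Lemma class_C2_consistently_varying X Y :
  class_C2 P X Y <-> [/\ class_C (distribution P X), class_C (distribution P Y),
    forall x y, 0 < joint_tail X Y x y &
    consistently_varying (@minoo R) (fun p => joint_tail X Y p.1 p.2)].
Proof.
have Jm := minoo_radially_nonincreasing _ (joint_tail_nonincreasing X Y).
split=> [[cX cY J0 Jc]|[cX cY J0 [_ _ Jc]]]; split=> //.
  split=> //; first exact: nearW.
  move=> e e0.
  have zC : \forall z \near filter_prod (1 : R)^'- (1 : R)^'-,
      \forall p \near @minoo R,
      joint_tail X Y (z.1 * p.1) (z.2 * p.2) / joint_tail X Y p.1 p.2 <= 1 + e.
    exact: near_cvg_limf_esup1 Jc _ e0.
  have [[A B] [/= A1 B1] AB] := zC.
  have z1 : \forall z \near (1 : R)^'-, 0 < z < 1.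
    near=> z; apply/andP.
    by split; near: z; [exact: nbhs_left_gt|exact: nbhs_left_lt].
  have [c [c01 [Ac Bc]]] := filter_ex (filterI z1 (filterI A1 B1)).
  exists c => //; have := AB (c, c) (conj Ac Bc).
  by apply: filterS => p; rewrite ler_pdivrMr.
apply: cvg_limf_esup1 => e e0; have [c /andP[c0 c1] Jce] := Jc e e0.
have z1 : \forall z \near (1 : R)^'-, c < z < 1.
  near=> z; apply/andP.
  by split; near: z; [exact: nbhs_left_gt|exact: nbhs_left_lt].
exists ([set z | c < z < 1], [set z | c < z < 1]) => //.
move=> [z1' z2'] /= [/andP[cz1 z11] /andP[cz2 z21]].
apply: filterS2 (minoo_gt 0) Jce => p [p1 p2] Jp.
rewrite ler_pdivlMr// mul1r ler_pdivrMr//; apply/andP; split.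
  by apply: joint_tail_nonincreasing; rewrite ger_pMl// ltW.
apply: le_trans Jp.
by apply: joint_tail_nonincreasing; rewrite ler_pM2r// ltW.
Unshelve. all: by end_near. Qed.

Variables X Y : 'I_2 -> {RV P >-> R}.

Definition sum_joint_tails (p : R * R) : R :=
  (joint_tail (X ord0) (Y ord0) p.1 p.2 +
   joint_tail (X ord_max) (Y ord0) p.1 p.2) +
  (joint_tail (X ord0) (Y ord_max) p.1 p.2 +
   joint_tail (X ord_max) (Y ord_max) p.1 p.2).

(** These eight probabilities are the numerators in the definition of GQAI. *)
Definition joint_two_jumps (p : R * R) : R :=
  two_jumps (X ord0) (X ord_max) p.1 (exceeds (Y ord0) p.2) +
  two_jumps (X ord0) (X ord_max) p.1 (exceeds (Y ord_max) p.2) +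
  (two_jumps (Y ord0) (Y ord_max) p.2 (exceeds (X ord0) p.1) +
   two_jumps (Y ord0) (Y ord_max) p.2 (exceeds (X ord_max) p.1)).

(** [sum_exceeds_le] is applied to the X's on the event about Y1 + Y2, then to
    the Y's on each event Xi > c x.  The remainder of the first step still
    carries Y1 + Y2, which is replaced by a single Yj at a smaller level. *)
Lemma joint_tail_sum_le (p : R * R) c : 0 < c < 1 -> 0 < p.1 -> 0 < p.2 ->
  joint_tail (P := P) (X ord0 + X ord_max) (Y ord0 + Y ord_max) p.1 p.2 <=
  sum_joint_tails (c *: p) + joint_two_jumps ((c * (1 - c)) *: p).
Proof.
case: p => x y /= c01 x0 y0; have [] := jump_level _ c01.
set v := c * (1 - c) => v0 vc v2 cv1 _.
have sX := @sum_exceeds_le _ _ _ P (X ord0) (X ord_max) x (c * x) (v * x)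
   (exceeds (Y ord0 + Y ord_max) y) ltac:(by []) ltac:(nra).
have sY i := @sum_exceeds_le _ _ _ P (Y ord0) (Y ord_max) y (c * y) (v * y)
   (exceeds (X i) (c * x)) ltac:(by []) ltac:(nra).
have jY i : two_jumps (Y ord0) (Y ord_max) (v * y) (exceeds (X i) (c * x)) <=
            two_jumps (Y ord0) (Y ord_max) (v * y) (exceeds (X i) (v * x)).
  apply: two_jumps_le => // w; rewrite /exceeds/=; apply: le_lt_trans.
  by rewrite ler_pM2r.
have jX := @two_jumps_exceeds_sum_le _ _ _ P (X ord0) (X ord_max)
  (Y ord0) (Y ord_max) (v * x) y (v * y) ltac:(nra).
rewrite /sum_joint_tails /joint_two_jumps !joint_tailE /=.
have sY0 := sY ord0; have sY1 := sY ord_max.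
rewrite !(setIC (exceeds (Y _) _)) !(setIC (exceeds (Y _ + _) _)) in sY0 sY1.
have := jY ord0; have := jY ord_max; lra.
Qed.

Lemma joint_tail_sum_ge (p : R * R) c : 0 < c < 1 -> 0 < p.1 -> 0 < p.2 ->
  sum_joint_tails (c^-1 *: p) <=
  joint_tail (P := P) (X ord0 + X ord_max) (Y ord0 + Y ord_max) p.1 p.2 +
  joint_two_jumps ((c * (1 - c)) *: p).
Proof.
case: p => x y /= c01 x0 y0; have [] := jump_level _ c01.
set v := c * (1 - c) => v0 _ v2 _ ci.
have vci : v <= c^-1 by lra.
have sX := @sum_exceeds_ge _ _ _ P (X ord0) (X ord_max) x (c^-1 * x) (v * x)
   (exceeds (Y ord0 + Y ord_max) y) ltac:(by []) ltac:(nra) ltac:(nra).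
have sY i := @sum_exceeds_ge _ _ _ P (Y ord0) (Y ord_max) y (c^-1 * y) (v * y)
   (exceeds (X i) (c^-1 * x)) ltac:(by []) ltac:(nra) ltac:(nra).
have jY i : two_jumps (Y ord0) (Y ord_max) (v * y) (exceeds (X i) (c^-1 * x)) <=
            two_jumps (Y ord0) (Y ord_max) (v * y) (exceeds (X i) (v * x)).
  apply: two_jumps_le => // w; rewrite /exceeds/=; apply: le_lt_trans.
  by rewrite ler_pM2r.
have jX := @two_jumps_exceeds_sum_le _ _ _ P (X ord0) (X ord_max)
  (Y ord0) (Y ord_max) (v * x) y (v * y) ltac:(nra).
rewrite /sum_joint_tails /joint_two_jumps !joint_tailE /=.
have sY0 := sY ord0; have sY1 := sY ord_max.
rewrite !(setIC (exceeds (Y _) _)) !(setIC (exceeds (Y _ + _) _)) in sY0 sY1.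
have := jY ord0; have := jY ord_max; lra.
Qed.

Lemma sum_joint_tails_consistently_varying :
  (forall i j, consistently_varying (@minoo R)
    (fun p => joint_tail (X i) (Y j) p.1 p.2)) ->
  consistently_varying (@minoo R) sum_joint_tails.
Proof.
move=> cvJ; rewrite /sum_joint_tails; do 2?apply: consistently_varyingD; exact: cvJ.
Qed.

Lemma joint_tail_sum_equivalent :
  consistently_varying (@minoo R) sum_joint_tails ->
  joint_two_jumps p / sum_joint_tails p @[p --> @minoo R] --> 0 ->
  joint_tail (P := P) (X ord0 + X ord_max) (Y ord0 + Y ord_max) p.1 p.2 /
    sum_joint_tails p @[p --> @minoo R] --> (1 : R).
Proof.
move=> cvT jumps.
apply: (sandwich_equivalent scaling_minoo
  (fun p => joint_tail (P := P) (X ord0 + X ord_max) (Y ord0 + Y ord_max) p.1 p.2)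
  sum_joint_tails joint_two_jumps) => //.
- by move=> p; do 2?apply: addr_ge0; exact: two_jumps_ge0.
- move=> c c01; apply: filterS (minoo_gt 0) => p [p1 p2].
  exact: joint_tail_sum_le.
- move=> c c01; apply: filterS (minoo_gt 0) => p [p1 p2].
  exact: joint_tail_sum_ge.
Qed.

(** GQAI compares each remainder with two of the four joint tails, hence a
    fortiori with their sum. *)
Lemma GQAI_joint_two_jumps : (forall i j x y, 0 < joint_tail (X i) (Y j) x y) ->
  GQAI X Y -> joint_two_jumps p / sum_joint_tails p @[p --> @minoo R] --> 0.
Proof.
move=> J0 [gX gY].
have and3E (A B C : T -> Prop) :
    [set w | [/\ A w, B w & C w]] =
    [set w | A w] `&` [set w | B w] `&` [set w | C w].
  by apply/seteqP; split=> [w []|w [[]]].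
have jX j : two_jumps (X ord0) (X ord_max) p.1 (exceeds (Y j) p.2) /
    sum_joint_tails p @[p --> @minoo R] --> 0.
  apply: (negligible_le _ (fun p => joint_tail (X ord0) (Y j) p.1 p.2 +
      joint_tail (X ord_max) (Y j) p.1 p.2)).
  - by move=> p; exact: two_jumps_ge0.
  - apply: nearW => p; rewrite addr_gt0//= /sum_joint_tails.
    have J0' i' j' := ltW (J0 i' j' p.1 p.2).
    by case: (ord2_cases j) => ->; rewrite ?lerDl ?lerDr addr_ge0.
  rewrite -[X in _ --> X]addr0.
  apply: cvg_trans (cvgD (proj2 (gX ord0 ord_max j isT))
    (proj2 (gX ord_max ord0 j isT))); apply: near_eq_cvg; apply: nearW => p /=.
  by rewrite addrfctE mulrDl !and3E [in X in _ = _ + _ / X]addrC.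
have jY i : two_jumps (Y ord0) (Y ord_max) p.2 (exceeds (X i) p.1) /
    sum_joint_tails p @[p --> @minoo R] --> 0.
  apply: (negligible_le _ (fun p => joint_tail (X i) (Y ord0) p.1 p.2 +
      joint_tail (X i) (Y ord_max) p.1 p.2)).
  - by move=> p; exact: two_jumps_ge0.
  - apply: nearW => p; rewrite addr_gt0//= /sum_joint_tails addrACA.
    have J0' i' j' := ltW (J0 i' j' p.1 p.2).
    by case: (ord2_cases i) => ->; rewrite ?lerDl ?lerDr addr_ge0.
  rewrite -[X in _ --> X]addr0.
  apply: cvg_trans (cvgD (proj2 (gY ord0 ord_max i isT))
    (proj2 (gY ord_max ord0 i isT))); apply: near_eq_cvg; apply: nearW => p /=.
  by rewrite addrfctE mulrDl !and3E [in X in _ = _ + _ / X]addrC.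
rewrite -[X in _ --> X]addr0 -[X in _ --> X + _]addr0 -[X in _ --> _ + X]addr0.
apply: cvg_trans (cvgD (cvgD (jX ord0) (jX ord_max))
  (cvgD (jY ord0) (jY ord_max))); apply: near_eq_cvg; apply: nearW => p /=.
by rewrite -!mulrDl.
Qed.

End two_dimensional_sum.

(** * Stability of the classes under sums *)

Section theorem_parts.
Context {d : measure_display} {T : measurableType d} {R : realType}.
Variable P : probability T R.
Variables X Y : 'I_2 -> {RV P >-> R}.

Lemma class_C_sum (Z : 'I_2 -> {RV P >-> R}) : QAI Z ->
  (forall i, class_C (distribution P (Z i))) ->
  class_C (distribution P (Z ord0 + Z ord_max)).
Proof.
move=> qZ CZ.
have cvT : consistently_varying (pinfty_nbhs R)
    (tail (distribution P (Z ord0)) \+ tail (distribution P (Z ord_max))).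
  by apply: consistently_varyingD;
    apply: (proj2 (iffLR (class_C_consistently_varying _) (CZ _))).
have [T0 _ _] := cvT.
have ST := tail_sum_equivalent _ _ cvT (QAI_two_jumps _ qZ).
apply: (iffRL (class_C_consistently_varying _)); split.
  by apply: tail_gt0_near; exact: equivalent_gt0 T0 ST.
apply: (consistently_varying_equivalent scaling_pinfty _ _ cvT _ ST).
apply: pinfty_radially_nonincreasing; exact: tail_nonincreasing.
Qed.

Lemma class_RV_consistently_varying a (F : probability R R) : 0 < a ->
  class_RV a F -> consistently_varying (pinfty_nbhs R) (tail F).
Proof.
move=> a0 [F0 Fa]; apply: (regular_consistently_varying _ a) => //.
- exact: nearW.
- apply: pinfty_radially_nonincreasing; exact: tail_nonincreasing.
Qed.

Lemma class_RV_sum a (Z : 'I_2 -> {RV P >-> R}) : 0 < a -> QAI Z ->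
  (forall i, class_RV a (distribution P (Z i))) ->
  class_RV a (distribution P (Z ord0 + Z ord_max)).
Proof.
move=> a0 qZ RVZ.
have cvT : consistently_varying (pinfty_nbhs R)
    (tail (distribution P (Z ord0)) \+ tail (distribution P (Z ord_max))).
  by apply: consistently_varyingD; exact: class_RV_consistently_varying a0 _.
have [T0 _ _] := cvT.
have ST := tail_sum_equivalent _ _ cvT (QAI_two_jumps _ qZ).
split; first by apply: tail_gt0_near; exact: equivalent_gt0 T0 ST.
move=> t t0; apply: (equivalent_ratio (fun x => t * x) _ _ _ _ T0 ST).
  by move=> A FA; exact: scaling_pinfty.
have [[Z0 Z0t] [Z1 Z1t]] := (RVZ ord0, RVZ ord_max).
apply: (regularly_varyingD (fun x => t * x)); [exact: nearW|exact: nearW|..].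
- exact: Z0t.
- exact: Z1t.
Qed.

Lemma class_C2_sum : GQAI X Y -> QAI X -> QAI Y ->
  (forall i j, class_C2 P (X i) (Y j)) ->
  class_C2 P (X ord0 + X ord_max) (Y ord0 + Y ord_max).
Proof.
move=> gXY qX qY CXY.
have cvJ i j := iffLR (class_C2_consistently_varying (X i) (Y j)) (CXY i j).
have J0 i j : forall x y, 0 < joint_tail (X i) (Y j) x y by case: (cvJ i j).
have cvT := sum_joint_tails_consistently_varying _ _
  (fun i j => let: And4 _ _ _ c := cvJ i j in c).
have [T0 _ _] := cvT.
have ST := joint_tail_sum_equivalent _ _ cvT (GQAI_joint_two_jumps _ _ J0 gXY).
apply: (iffRL (class_C2_consistently_varying _ _)); split.
- by apply: class_C_sum => // i; case: (CXY i ord0).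
- by apply: class_C_sum => // j; case: (CXY ord0 j).
- by apply: joint_tail_gt0_near; exact: equivalent_gt0 T0 ST.
- apply: (consistently_varying_equivalent scaling_minoo _ _ cvT _ ST).
  apply: minoo_radially_nonincreasing; exact: joint_tail_nonincreasing.
Qed.

Lemma class_RV2_sum a1 a2 : 0 < a1 -> 0 < a2 -> GQAI X Y -> QAI X -> QAI Y ->
  (forall i j, class_RV2 P a1 a2 (X i) (Y j)) ->
  class_RV2 P a1 a2 (X ord0 + X ord_max) (Y ord0 + Y ord_max).
Proof.
move=> a10 a20 gXY qX qY RVXY.
have J0 i j : forall x y, 0 < joint_tail (X i) (Y j) x y by case: (RVXY i j).
have cvJ i j : consistently_varying (@minoo R)
    (fun p => joint_tail (X i) (Y j) p.1 p.2).
  have [_ _ _ Jt] := RVXY i j.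
  apply: (regular_consistently_varying _ (a1 + a2)); first exact: addr_gt0.
  - exact: nearW.
  - apply: minoo_radially_nonincreasing; exact: joint_tail_nonincreasing.
  - move=> c c0; rewrite opprD powRD; first exact: Jt.
    by rewrite (gt_eqF c0) implybT.
have cvT := sum_joint_tails_consistently_varying _ _ cvJ.
have [T0 _ _] := cvT.
have ST := joint_tail_sum_equivalent _ _ cvT (GQAI_joint_two_jumps _ _ J0 gXY).
split.
- by apply: class_RV_sum => // i; case: (RVXY i ord0).
- by apply: class_RV_sum => // j; case: (RVXY ord0 j).
- by apply: joint_tail_gt0_near; exact: equivalent_gt0 T0 ST.
move=> t1 t2 t10 t20; pose phi (p : R * R) := (t1 * p.1, t2 * p.2).
apply: (equivalent_ratio phi _ _ _ _ T0 ST).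
  move=> A [[A1 A2] [/= A1F A2F] sA].
  exists ([set x | A1 (t1 * x)], [set x | A2 (t2 * x)]).
    by split; exact: scaling_pinfty.
  by move=> [x y] [/= ? ?]; exact: sA.
have Jt i j : joint_tail (X i) (Y j) (t1 * p.1) (t2 * p.2) /
    joint_tail (X i) (Y j) p.1 p.2 @[p --> @minoo R] --> t1 `^ (- a1) * t2 `^ (- a2).
  by case: (RVXY i j) => _ _ _; exact.
have JN i j : \forall p \near @minoo R, 0 < joint_tail (X i) (Y j) p.1 p.2.
  exact: nearW.
pose Jcol j (p : R * R) := joint_tail (X ord0) (Y j) p.1 p.2 +
  joint_tail (X ord_max) (Y j) p.1 p.2.
have Jcol0 j : \forall p \near @minoo R, 0 < Jcol j p.
  by apply: nearW => p; exact: addr_gt0.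
have Jcolt j : Jcol j (phi p) / Jcol j p @[p --> @minoo R] -->
    t1 `^ (- a1) * t2 `^ (- a2).
  exact: (regularly_varyingD phi _ _ _ (JN _ j) (JN _ j) (Jt _ j) (Jt _ j)).
exact: (regularly_varyingD phi (Jcol ord0) (Jcol ord_max)).
Qed.

End theorem_parts.

Theorem theorem4p1 (d : measure_display) (T : measurableType d) (R : realType)
    (P : probability T R) (X Y : 'I_2 -> {RV P >-> R})
    (X_tail : forall i x, 0 < tail (distribution P (X i)) x)
    (Y_tail : forall j y, 0 < tail (distribution P (Y j)) y) :
  (GQAI X Y -> QAI X -> QAI Y ->
   (forall i j, class_C2 P (X i) (Y j)) ->
   class_C2 P (X ord0 + X ord_max)
            (Y ord0 + Y ord_max))
  /\
  (GQAI X Y -> QAI X -> QAI Y ->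
   forall a1 a2 : R, 0 < a1 -> 0 < a2 ->
   (forall i, class_RV a1 (distribution P (X i))) ->
   (forall j, class_RV a2 (distribution P (Y j))) ->
   (forall i j, class_RV2 P a1 a2 (X i) (Y j)) ->
   class_RV2 P a1 a2 (X ord0 + X ord_max)
                   (Y ord0 + Y ord_max)).
Proof.
split=> [gXY qX qY CXY|gXY qX qY a1 a2 a10 a20 _ _ RVXY].
  exact: class_C2_sum.
exact: class_RV2_sum.
Qed.
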